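(* Let $\mathcal{H}$ be a complex Hilbert space, let $A\in\mathcal{B}(\mathcal{H})$, and let $\tilde{A}$ be the Aluthge transform of $A$. Then $$ w(A)\leq\frac{1}{2}\left(\|A\|^2+w^2(\tilde{A})+w\big(|A|\tilde{A}+\tilde{A}|A|\big)\right)^{\frac{1}{2}}. $$
   Context: $\mathcal{B}(\mathcal{H})$ denotes the $C^*$-algebra of bounded linear operators on the complex Hilbert space $\mathcal{H}$, with operator norm $\|\cdot\|$. For $A\in\mathcal{B}(\mathcal{H})$, $|A|=(A^*A)^{1/2}$. The numerical radius is $w(A)=\sup\{|\langle Ax,x\rangle|: x\in\mathcal{H},\ \|x\|=1\}$, and $w^2(A)=(w(A))^2$. The Aluthge transform of $A$ is $\tilde{A}=|A|^{1/2}U|A|^{1/2}$, where $U$ is the unique partial isometry in the polar decomposition $A=U|A|$ with $\ker U=\ker A$. *)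

(* Defs.v *)
From HB Require Import structures.
From mathcomp Require Import all_boot all_order all_algebra complex.
From mathcomp Require Import all_classical all_reals all_analysis.

Set Implicit Arguments.
Unset Strict Implicit.
Unset Printing Implicit Defensive.

Import Order.TTheory GRing.Theory Num.Theory.
Import numFieldNormedType.Exports.

Local Open Scope classical_set_scope.
Local Open Scope ring_scope.
Local Open Scope complex_scope.

(* The inner product is linear in its first argument. The norm of H takes its
   values in R[i]; its imaginary part is zero. *)
HB.mixin Record NormedModule_isHilbert (R : realType) H
    & CompleteNormedModule R[i] H := {
  dotp : {dot H for (@conjc R)} ;
  dotp_norm : forall x : H, dotp x x = `|x| ^+ 2
}.

#[short(type="hilbertType")]
HB.structure Definition Hilbert (R : realType) :=
  {H of CompleteNormedModule R[i] H & NormedModule_isHilbert R H}.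

Section operators.
Context {R : realType} {H : hilbertType R}.
Implicit Types (A B P S U : H -> H) (x y : H).

Local Notation "''[' x , y ]" := (dotp x y) : ring_scope.

Definition bounded_op A : Prop :=
  linear A /\ exists M : R, forall x, `|A x| <= M%:C * `|x|.

Definition opnorm A : R :=
  sup [set complex.Re `|A x| | x in [set x : H | `|x| <= 1]].

Definition numrad A : R :=
  sup [set complex.Re `|'[A x, x]| | x in [set x : H | `|x| = 1]].

Definition is_adjoint A B : Prop :=
  bounded_op B /\ forall x y, '[A x, y] = '[x, B y].

Definition positive_op P : Prop :=
  bounded_op P /\ forall x, 0 <= '[P x, x].

Definition is_sqrt_op P S : Prop := positive_op S /\ S \o S = P.

Definition ker_op A : set H := [set x | A x = 0].

Definition partial_isometry U : Prop :=
  bounded_op U /\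
  forall x, (forall y, ker_op U y -> '[x, y] = 0) -> `|U x| = `|x|.

(* [get] picks an element of a set, and a default value if the set is empty.
   The sets below are singletons for a bounded operator A and a positive
   operator P, by the Riesz representation theorem, the existence and
   uniqueness of positive square roots, and the polar decomposition. *)
Definition adjoint_op A : H -> H := get (is_adjoint A).

Definition sqrt_op P : H -> H := get (is_sqrt_op P).

Definition abs_op A : H -> H := sqrt_op (adjoint_op A \o A).

Definition is_polar_factor A U : Prop :=
  [/\ partial_isometry U, A = U \o abs_op A & ker_op U = ker_op A].

Definition polar_factor A : H -> H := get (is_polar_factor A).

Definition aluthge A : H -> H :=
  sqrt_op (abs_op A) \o polar_factor A \o sqrt_op (abs_op A).

End operators.

(* Main.v *)
(* Write A = U|A|, S = |A|^(1/2), and let c be a unit complex number. With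
   T = S (c + U^* ), polarization gives Re <c A x, x> <= |T x|^2 / 4, and
   |T|^2 = |T T^*| where T T^* = 2 (|A| + D), D being the real part of c times
   the Aluthge transform (here U is isometric on the range of S). Finally
   |(|A| + D) y|^2 = |(|A| y)|^2 + |D y|^2 + 2 Re <|A| y, D y>, and the three
   terms are bounded by the three terms under the root, the norm of the
   self-adjoint D being its numerical radius. A supremum over c concludes.

   Riesz representation and orthogonal projection, which yield the adjoint and
   the polar factor, are one minimization problem for the real inner product
   Re <x, y>. *)
Require Import Defs.
From HB Require Import structures.
From mathcomp Require Import all_boot all_order all_algebra complex.
From mathcomp Require Import all_classical all_reals all_analysis.
From mathcomp Require Import ring lra.
Local Open Scope ring_scope.
Set Implicit Arguments.
Unset Strict Implicit.
Unset Printing Implicit Defensive.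
Import Order.TTheory GRing.Theory Num.Theory.
Import numFieldNormedType.Exports.
Local Open Scope classical_set_scope.
Local Open Scope complex_scope.

(** * The real inner product and the norm *)

Section RealInnerProduct.
Context {R : realType} {H : hilbertType R}.
Implicit Types (x y z : H) (a : R) (c : R[i]).

Definition nrm x : R := complex.Re `|x|.
Definition rdot x y : R := complex.Re (dotp x y).

Lemma normE x : `|x| = (nrm x)%:C.
Proof. by rewrite /nrm RRe_real // normr_real. Qed.

Lemma nrm_ge0 x : 0 <= nrm x.
Proof. by rewrite -ler0c -normE. Qed.

Lemma nrm_eq0 x : nrm x = 0 -> x = 0.
Proof. by move=> h; apply/eqP; rewrite -normr_eq0 normE h. Qed.

Lemma nrm0 : nrm 0 = 0 :> R.
Proof. by rewrite /nrm normr0. Qed.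

Lemma nrmN x : nrm (- x) = nrm x.
Proof. by rewrite /nrm normrN. Qed.

Lemma nrmD x y : nrm (x + y) <= nrm x + nrm y.
Proof. by rewrite -lecR rmorphD /= -!normE ler_normD. Qed.

Lemma nrmBC x y : nrm (x - y) = nrm (y - x).
Proof. by rewrite -nrmN opprB. Qed.

Lemma nrmB_trans z x y : nrm (x - y) <= nrm (x - z) + nrm (z - y).
Proof. by rewrite (_ : x - y = (x - z) + (z - y)) ?nrmD // addrA subrK. Qed.

Lemma nrmZ c x : nrm (c *: x) = complex.Re `|c| * nrm x.
Proof.
by rewrite {1}/nrm normrZ normE -[`|c|]RRe_real ?normr_real // -rmorphM.
Qed.

Lemma nrmZr a x : nrm (a%:C *: x) = `|a| * nrm x.
Proof. by rewrite nrmZ normc_def /= expr0n /= addr0 sqrtr_sqr. Qed.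

Lemma nrm_sqr x : nrm x ^+ 2 = rdot x x.
Proof.
by apply: (@complexI R); rewrite rmorphXn /= -normE /rdot dotp_norm normE -rmorphXn.
Qed.

Lemma dotC x y : dotp y x = conjc (dotp x y).
Proof. by rewrite hermitian_subproof expr0 mul1r. Qed.

Lemma dotZl c x y : dotp (c *: x) y = c * dotp x y.
Proof. exact: linearZl_LR. Qed.

Lemma dotZr c x y : dotp x (c *: y) = conjc c * dotp x y.
Proof. by rewrite dotC dotZl rmorphM /= [in RHS]dotC. Qed.

Lemma rdotC x y : rdot x y = rdot y x.
Proof. by rewrite /rdot [in RHS]dotC; case: (dotp x y). Qed.

Lemma rdotDl x y z : rdot (x + y) z = rdot x z + rdot y z.
Proof. by rewrite /rdot linearDl raddfD. Qed.

Lemma rdotDr x y z : rdot z (x + y) = rdot z x + rdot z y.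
Proof. by rewrite !(rdotC z) rdotDl. Qed.

Lemma rdotNl x y : rdot (- x) y = - rdot x y.
Proof. by rewrite /rdot linearNl raddfN. Qed.

Lemma rdotNr x y : rdot x (- y) = - rdot x y.
Proof. by rewrite !(rdotC x) rdotNl. Qed.

Lemma rdotZ c x y : rdot (c *: x) y = rdot x (conjc c *: y).
Proof. by rewrite /rdot dotZl dotZr conjcK. Qed.

Lemma rdotZrl a x y : rdot (a%:C *: x) y = a * rdot x y.
Proof. by rewrite /rdot dotZl; case: (dotp x y) => u v /=; rewrite mul0r subr0. Qed.

Lemma rdotZrr a x y : rdot x (a%:C *: y) = a * rdot x y.
Proof. by rewrite !(rdotC x) rdotZrl. Qed.

Definition rdotE := (rdotDl, rdotDr, rdotNl, rdotNr, rdotZrl, rdotZrr).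

Lemma rdot0l x : rdot 0 x = 0.
Proof. by have := rdotDl 0 0 x; rewrite addr0; lra. Qed.

Lemma rdot0r x : rdot x 0 = 0.
Proof. by rewrite rdotC rdot0l. Qed.

(** Conjugate-linearity in the second argument turns ['i *: y] into the factor [- 'i], whose real
    part picks out the imaginary part. Real identities valid for all vectors thus yield complex
    ones. *)
Lemma dotE x y : dotp x y = rdot x y +i* rdot x ('i *: y).
Proof.
rewrite /rdot dotZr; case: (dotp x y) => u v /=.
by apply/eqP; rewrite eq_complex /= eqxx /=; apply/eqP; ring.
Qed.

Lemma rdot_ext x y : (forall z, rdot x z = rdot y z) -> x = y.
Proof.
move=> h; apply/eqP; rewrite -subr_eq0; apply/eqP/nrm_eq0/eqP.
rewrite -sqrf_eq0 nrm_sqr; apply/eqP.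
by rewrite {1}rdotDl rdotNl h subrr.
Qed.

Lemma CauchySchwarz x y : rdot x y <= nrm x * nrm y.
Proof.
have [/eqP/nrm_eq0 ->|y0] := boolP (nrm y == 0).
  by rewrite nrm0 rdot0r mulr0.
have [/eqP/nrm_eq0 ->|x0] := boolP (nrm x == 0).
  by rewrite nrm0 rdot0l mul0r.
have yp : 0 < nrm y by rewrite lt_neqAle eq_sym y0 nrm_ge0.
have xp : 0 < nrm x by rewrite lt_neqAle eq_sym x0 nrm_ge0.
(* The square expands to [2 |x| |y| (|x| |y| - rdot x y)], and [|x| |y|] is positive. *)
have := sqr_ge0 (nrm ((nrm y)%:C *: x - (nrm x)%:C *: y)).
rewrite nrm_sqr !rdotE -!nrm_sqr (rdotC y x) => h.
rewrite -(ler_pM2l (mulr_gt0 xp yp)); nra.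
Qed.

Lemma absCauchySchwarz x y : `|rdot x y| <= nrm x * nrm y.
Proof.
rewrite ler_norml CauchySchwarz andbT lerNl -rdotNl -(nrmN x).
exact: CauchySchwarz.
Qed.

(** Limit arguments below take this form: an error bound at every [n], with [e] only required to
    take arbitrarily small values. *)
Lemma small_eq0 a (e : nat -> R) (K : R) : 0 <= K ->
  (forall d : R, 0 < d -> exists n, e n <= d) ->
  (forall n, `|a| <= K * e n) -> a = 0.
Proof.
move=> K0 he ha; apply/eqP; rewrite -normr_le0; apply/ler_addgt0Pr => d d0.
have K1 : 0 < K + 1 by rewrite ltr_wpDl.
have [n en] := he (d / (K + 1)) (divr_gt0 d0 K1).
rewrite add0r; apply: (le_trans (ha n)); apply: (le_trans (ler_wpM2l K0 en)).
by rewrite mulrCA ler_piMr ?(ltW d0) // ler_pdivrMr // mul1r lerDl.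
Qed.

End RealInnerProduct.

(** * Limits with explicit rates and the variational problem *)

Section Completeness.
Context {R : realType} {H : hilbertType R}.
Implicit Types (x y z : H) (a : R) (c : R[i]).

Lemma pos_complexE (c : R[i]) : 0 < c -> exists2 d : R, 0 < d & c = d%:C.
Proof.
by case: c => a b; rewrite ltcE /= => /andP[/eqP -> a0]; exists a.
Qed.

Lemma cauchy_rate (u : nat -> H) (e : nat -> R) :
  (forall d : R, 0 < d -> exists n, e n <= d) ->
  (forall n m, (n <= m)%N -> nrm (u m - u n) <= e n) ->
  exists v, forall n, nrm (v - u n) <= e n.
Proof.
move=> he hu.
have : cauchy (u @ \oo).
  apply: cauchy_exP => c /pos_complexE [d d0 ->].
  have [n en] := he (d / 2) (divr_gt0 d0 (ltr0Sn _ _)).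
  exists (u n), n => // m /= nm; rewrite -ball_normE /ball_ /= normE ltcR nrmBC.
  by have := hu n m nm; lra.
move=> /cauchy_cvg /cvg_ex [v uv]; exists v => n.
apply/ler_addgt0Pr => d d0.
have : nbhs v (ball v d%:C) by apply: nbhsx_ballx; rewrite ltcR.
move=> /uv [k _ hk].
have := hk (maxn n k) (leq_maxr n k).
rewrite -ball_normE /ball_ /= normE ltcR => h.
by have := hu n _ (leq_maxl n k); have := nrmB_trans (u (maxn n k)) v (u n); lra.
Qed.

Lemma invS_small (d : R) : 0 < d -> exists n, n.+1%:R^-1 <= d.
Proof.
move=> d0; exists (Num.truncn d^-1).
rewrite invf_ple ?posrE ?ltr0Sn //.
by apply: ltW; rewrite truncnS_gt.
Qed.

Lemma invS_le n m : (n <= m)%N -> m.+1%:R^-1 <= n.+1%:R^-1 :> R.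
Proof. by move=> nm; rewrite lef_pV2 ?posrE ?ltr0Sn // ler_nat ltnS. Qed.

(** At [t = - a / k] with [k = 1 + |b|] the quadratic equals [a ^+ 2 * (b - 2 * k) / k ^+ 2], and
    [b < 2 * k]. *)
Lemma nonneg_quadratic a b : (forall t, 0 <= 2 * t * a + t ^+ 2 * b) -> a = 0.
Proof.
move=> h; have := h (- a / (1 + `|b|)); set k := 1 + `|b|.
have k0 : 0 < k by rewrite /k ltr_wpDr.
have bk : b <= k - 1 by rewrite /k addrC addKr ler_norm.
rewrite (_ : _ + _ = a ^+ 2 * (b - 2 * k) / k ^+ 2); last by field; lra.
rewrite pmulr_lge0 ?invr_gt0 ?exprn_gt0 // => h2.
by apply/eqP; rewrite -sqrf_eq0; apply/eqP; have := sqr_ge0 a; nra.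
Qed.

(* The minimizer of [nrm u ^+ 2 - 2 * f u] over the real subspace [V]:
   the Riesz representation of [f] when [V] is everything, the orthogonal
   projection of [x] on the closure of [V] when [f] is [rdot x]. *)
Lemma variational (V : set H) (f : H -> R) (M : R) :
  V 0 -> (forall x y a, V x -> V y -> V (a%:C *: x + y)) ->
  (forall x y a, V x -> V y -> f (a%:C *: x + y) = a * f x + f y) ->
  (forall x, V x -> `|f x| <= M * nrm x) ->
  exists v, (forall u, V u -> rdot v u = f u) /\
    forall d : R, 0 < d -> exists2 u, V u & nrm (v - u) <= d.
Proof.
move=> V0 VD fD fM.
pose J x := nrm x ^+ 2 - 2 * f x.
have hasinf : has_inf (J @` V).
  split; first by exists (J 0), 0.
  (* [J x >= |x|^2 - 2 M |x| >= - M^2], by completing the square. *)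
  exists (- M ^+ 2) => _ [x Vx <-]; rewrite /J.
  by have := fM x Vx; rewrite ler_norml => /andP[_ h]; have := sqr_ge0 (nrm x - M); nra.
pose d := inf (J @` V).
have dJ x : V x -> d <= J x.
  by move=> Vx; apply: ge_inf; [exact: hasinf.2|exists x].
pose e n : R := n.+1%:R^-1.
have e0 n : 0 < e n by rewrite invr_gt0 ltr0Sn.
(* With this tolerance, [para] gives [|u m - u n|^2 <= (e m ^+ 2 + e n ^+ 2) / 2 <= e n ^+ 2] for
   [n <= m]. *)
have /choice[u hu] n : exists x, V x /\ J x < d + (e n / 2) ^+ 2.
  have [|_ [x Vx <-] h] := @inf_adherent R _ ((e n / 2) ^+ 2) _ hasinf.
    by rewrite exprn_gt0 // divr_gt0.
  by exists x.
(* Parallelogram law: the left side is [2 J x + 2 J y - 4 J z] for the midpoint [z], and [J z >= d].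
   The midpoint is written with a trailing 0 to match the closure hypothesis on [V]. *)
have para x y : V x -> V y -> nrm (x - y) ^+ 2 <= 2 * (J x - d) + 2 * (J y - d).
  move=> Vx Vy.
  have Vz : V ((1/2)%:C *: x + ((1/2)%:C *: y + 0)) by exact: VD Vx (VD _ _ _ Vy V0).
  have := dJ _ Vz; rewrite /J !fD //; last exact: VD Vy V0.
  have -> : f 0 = 0.
    by have := fD 0 0 1 V0 V0; rewrite addr0 scaler0; lra.
  by rewrite addr0 !nrm_sqr !rdotE (rdotC y x); lra.
have [v hv] : exists v, forall n, nrm (v - u n) <= e n.
  apply: cauchy_rate; first exact: invS_small.
  move=> n m nm.
  rewrite -(ler_pXn2r (ltn0Sn 1)) ?nnegrE ?nrm_ge0 ?(ltW (e0 _)) //.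
  have [Vn hn] := hu n; have [Vm hm] := hu m.
  apply: (le_trans (para _ _ Vm Vn)).
  have := invS_le nm; rewrite -/(e n) -/(e m) => h.
  by have := e0 n; have := e0 m; nra.
exists v; split; last first.
  move=> k k0; have [n hn] := invS_small k0.
  by exists (u n); [exact: (hu n).1|apply: le_trans hn].
move=> h Vh; apply/eqP; rewrite -subr_eq0; apply/eqP.
(* The quadratic is the variation of [J] at [v] in direction [h]. As [v] may lie outside [V],
   minimality is used at [u n + t h], and [v] is replaced by [u n] at a cost of [2 |t| |h| (e n)].
   The 1 in [K0] covers the tolerance [(e n / 2) ^+ 2 <= e n]. *)
apply: (@nonneg_quadratic _ (nrm h ^+ 2)) => t.
rewrite -oppr_le0; apply/ler_addgt0Pr => k k0; rewrite add0r.
have K0 : 0 < 1 + 2 * `|t| * nrm h by rewrite ltr_wpDr // !mulr_ge0 ?nrm_ge0.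
have [n hn] := invS_small (divr_gt0 k0 K0).
move: hn; rewrite ler_pdivlMr // -/(e n) => hn.
have [Vu Ju] := hu n.
have := dJ _ (VD _ _ t Vh Vu); rewrite {1}/J fD // => hd.
have e1 : e n <= 1 by rewrite invf_le1 ?ltr0Sn // ler1n.
have hsq : (e n / 2) ^+ 2 <= e n by have := e0 n; nra.
have := absCauchySchwarz (v - u n) h => hc.
have hc2 : `|t * rdot (v - u n) h| <= `|t| * nrm h * e n.
  rewrite normrM -mulrA ler_wpM2l //; apply: (le_trans hc).
  by rewrite mulrC ler_wpM2l ?nrm_ge0.
move: hc2 hd Ju; rewrite /J !nrm_sqr !rdotE (rdotC (u n) h) ler_norml.
by move=> /andP[h1 h2] hd Ju; nra.
Qed.

End Completeness.

(** * Bounded, adjoint, positive and self-adjoint operators *)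

Section BoundedOperators.
Context {R : realType} {H : hilbertType R}.
Implicit Types (A B P : H -> H) (x y z : H) (a : R) (c : R[i]).

Lemma bounded_opP A :
  bounded_op A <->
  linear A /\ exists2 M : R, 0 <= M & forall x, nrm (A x) <= M * nrm x.
Proof.
have e M x : (`|A x| <= M%:C * `|x|) = (nrm (A x) <= M * nrm x).
  by rewrite !normE -rmorphM lecR.
split=> -[lA [M]] => [hM|M0 hM]; split=> //.
  exists `|M| => // x; have := hM x; rewrite e => /le_trans; apply.
  by rewrite ler_wpM2r ?nrm_ge0 ?ler_norm.
by exists M => x; rewrite e.
Qed.

Section Linearity.
Variables (A : H -> H) (hA : bounded_op A).

Lemma opD x y : A (x + y) = A x + A y.
Proof. by have := hA.1 1 x y; rewrite !scale1r. Qed.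

Lemma op0 : A 0 = 0.
Proof. by apply: (addrI (A 0)); rewrite -opD !addr0. Qed.

Lemma opZ c x : A (c *: x) = c *: A x.
Proof. by have := hA.1 c x 0; rewrite op0 !addr0. Qed.

Lemma opN x : A (- x) = - A x.
Proof. by rewrite -scaleN1r opZ scaleN1r. Qed.

Lemma opB x y : A (x - y) = A x - A y.
Proof. by rewrite opD opN. Qed.

End Linearity.

Lemma bounded_op_comp A B : bounded_op A -> bounded_op B -> bounded_op (A \o B).
Proof.
move=> bA bB; apply/bounded_opP; split.
  by move=> c x y /=; rewrite (opD bB) (opD bA) (opZ bB) (opZ bA).
have /bounded_opP [_ [M M0 hM]] := bA; have /bounded_opP [_ [N N0 hN]] := bB.
exists (M * N); first exact: mulr_ge0.
by move=> x; apply: (le_trans (hM _)); rewrite -mulrA ler_wpM2l.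
Qed.

Lemma bounded_op_add A B : bounded_op A -> bounded_op B -> bounded_op (A \+ B).
Proof.
move=> bA bB; apply/bounded_opP; split.
  move=> c x y /=; rewrite (opD bB) (opD bA) (opZ bB) (opZ bA).
  by rewrite scalerDr addrACA.
have /bounded_opP [_ [M M0 hM]] := bA; have /bounded_opP [_ [N N0 hN]] := bB.
exists (M + N); first exact: addr_ge0.
move=> x; apply: (le_trans (nrmD _ _)).
by rewrite mulrDl lerD.
Qed.

Lemma bounded_op_scale c A : bounded_op A -> bounded_op (fun x => c *: A x).
Proof.
move=> bA; apply/bounded_opP; split.
  move=> d x y /=; rewrite (opD bA) (opZ bA).
  by rewrite scalerDr !scalerA mulrC.
have /bounded_opP [_ [M M0 hM]] := bA.
have c0 : 0 <= complex.Re `|c| by rewrite normc_def /= sqrtr_ge0.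
exists (complex.Re `|c| * M); first exact: mulr_ge0.
by move=> x; rewrite nrmZ -mulrA ler_wpM2l.
Qed.

Lemma bounded_op_id : bounded_op (fun x : H => x).
Proof.
by apply/bounded_opP; split=> //; exists 1 => // x; rewrite mul1r.
Qed.

Lemma sqr_le_mul (p q : R) : 0 <= p -> 0 <= q -> p ^+ 2 <= q * p -> p <= q.
Proof.
move=> p0 q0; have [->//|pn] := eqVneq p 0.
by rewrite expr2 ler_pM2r // lt_neqAle eq_sym pn.
Qed.

(** [B y] is the Riesz representative of the real functional [u |-> rdot (A u) y]. Complex linearity
    of [B] and the complex adjoint identity follow from the complex linearity of [A]. *)
Lemma adjoint_exists A : bounded_op A -> exists B, is_adjoint A B.
Proof.
move=> bA; have /bounded_opP [_ [M M0 hM]] := bA.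
have /choice [B hB] y : exists v, forall u, rdot v u = rdot (A u) y.
  have [//|//|u v a _ _|u _|v [hv _]] :=
    @variational R H setT (fun x => rdot (A x) y) (M * nrm y).
  - by rewrite (opD bA) (opZ bA) !rdotE.
  - apply: (le_trans (absCauchySchwarz _ _)).
    by rewrite mulrAC ler_wpM2r ?nrm_ge0.
  - by exists v => u; apply: hv.
have bB : bounded_op B.
  apply/bounded_opP; split.
    move=> c y z; apply: rdot_ext => u; rewrite hB !rdotDl rdotDr hB.
    congr (_ + _); rewrite rdotZ hB (opZ bA) [in RHS]rdotZ conjcK //.
  exists M => // y; apply: sqr_le_mul; rewrite ?mulr_ge0 ?nrm_ge0 //.
  rewrite nrm_sqr hB; apply: (le_trans (CauchySchwarz _ _)).
  by rewrite mulrAC ler_wpM2r ?nrm_ge0.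
exists B; split=> // x y.
by rewrite !dotE -(opZ bB) ![rdot x _]rdotC !hB.
Qed.

Lemma adjoint_opP A : bounded_op A -> is_adjoint A (adjoint_op A).
Proof. by move=> /adjoint_exists /getPex. Qed.

Lemma rdot_adjoint A B x y : is_adjoint A B -> rdot (A x) y = rdot x (B y).
Proof. by move=> [_ h]; rewrite /rdot h. Qed.

Definition selfadj A := bounded_op A /\ forall x y, rdot (A x) y = rdot x (A y).

Lemma conjc_i : conjc 'i = - 'i :> R[i].
Proof. by apply/eqP; rewrite eq_complex /= oppr0 !eqxx. Qed.

(** Positivity makes every [dotp (P y) y] real; polarizing the vanishing of the imaginary part gives
    symmetry. *)
Lemma positive_selfadj P : positive_op P -> selfadj P.
Proof.
move=> [bP hP]; split=> // x z.
have Im0 y : rdot (P y) ('i *: y) = 0.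
  by have := hP y; rewrite dotE lecE /= => /andP[/eqP].
have polar y : rdot (P x) ('i *: y) + rdot (P y) ('i *: x) = 0.
  by have := Im0 (x + y); rewrite scalerDr (opD bP) !rdotE !Im0; lra.
have ii : 'i * 'i = -1 :> R[i] by rewrite -expr2 sqr_i.
(* The choice [y = - 'i *: z] turns [polar] into [rdot (P x) z - rdot (P z) x = 0]. *)
have := polar (- 'i *: z).
rewrite (opZ bP) scalerA mulrN ii opprK scale1r rdotZ scalerA.
rewrite -conjc_i conjcK ii scaleN1r rdotNr (rdotC (P z)).
by move=> h; apply/eqP; rewrite -subr_eq0; apply/eqP.
Qed.

Lemma rdot_positive P x : positive_op P -> 0 <= rdot (P x) x.
Proof. by move=> [_ /(_ x)]; rewrite dotE lecE /= => /andP[]. Qed.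

Lemma selfadj_positive P :
  selfadj P -> (forall x, 0 <= rdot (P x) x) -> positive_op P.
Proof.
move=> [bP sP] hP; split=> // x; rewrite dotE lecE /= hP andbT.
have : rdot (P x) ('i *: x) = - rdot (P x) ('i *: x).
  rewrite {1}sP (opZ bP) rdotC rdotZ conjc_i scaleNr rdotNr.
  by rewrite rdotC.
by move=> h; apply/eqP; lra.
Qed.

(** By polarization and the parallelogram law, [4 rdot (D u) v <= w (|u + v|^2 + |u - v|^2) = 2 w
    (|u|^2 + |v|^2)]. This is applied to multiples [u] of [x] and [v] of [D x], scaled to the same
    norm [p * q]. *)
Lemma selfadj_norm D (w : R) : selfadj D ->
  (forall x, `|rdot (D x) x| <= w * nrm x ^+ 2) ->
  forall x, nrm (D x) <= w * nrm x.
Proof.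
move=> [bD sD] hw x.
have [/eqP/nrm_eq0 ->|x0] := boolP (nrm x == 0).
  by rewrite (op0 bD) nrm0 mulr0.
have p0 : 0 < nrm x by rewrite lt_neqAle eq_sym x0 nrm_ge0.
have w0 : 0 <= w.
  by rewrite -(pmulr_lge0 _ (exprn_gt0 2 p0)) (le_trans _ (hw x)).
have [->|q0'] := eqVneq (nrm (D x)) 0; first by rewrite mulr_ge0 // ltW.
have q0 : 0 < nrm (D x) by rewrite lt_neqAle eq_sym q0' nrm_ge0.
set p := nrm x in p0 *; set q := nrm (D x) in q0 *.
pose u := q%:C *: x; pose v := p%:C *: D x.
have h1 := hw (u + v); have h2 := hw (u - v).
have e1 : rdot u u = (p * q) ^+ 2.
  by rewrite !rdotE -nrm_sqr -/p; ring.
have e2 : rdot v v = (p * q) ^+ 2.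
  by rewrite !rdotE -nrm_sqr -/q; ring.
have e3 : rdot (D u) v = p * q * q ^+ 2.
  by rewrite (opZ bD) !rdotE -nrm_sqr -/q; ring.
have e4 : rdot (D v) u = rdot (D u) v by rewrite sD rdotC.
move: h1 h2; rewrite !nrm_sqr (opB bD) (opD bD) !ler_norml.
rewrite !(rdotDl, rdotDr, rdotNl, rdotNr) e1 e2 e4 e3 (rdotC v u).
move=> /andP[_ h1] /andP[h2 _].
have h : q * (p * q ^+ 2) <= w * p * (p * q ^+ 2) by nra.
by rewrite -(ler_pM2r (mulr_gt0 p0 (exprn_gt0 2 q0))).
Qed.

End BoundedOperators.

(** * Existence of positive square roots *)

Section SquareRoot.
Context {R : realType} {H : hilbertType R}.
Implicit Types (P : H -> H) (x y z : H) (a : R) (c : R[i]).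

Lemma lim_unique (u : nat -> H) (e : nat -> R) (K L : R) v w :
  0 <= K -> 0 <= L ->
  (forall d : R, 0 < d -> exists n, e n <= d) ->
  (forall n, nrm (v - u n) <= K * e n) -> (forall n, nrm (w - u n) <= L * e n) ->
  v = w.
Proof.
move=> K0 L0 he hv hw; apply/eqP; rewrite -subr_eq0; apply/eqP/nrm_eq0.
apply: (@small_eq0 _ _ e (K + L)) => //; first exact: addr_ge0.
move=> n; rewrite ger0_norm ?nrm_ge0 //.
have := nrmB_trans (u n) v w; rewrite (nrmBC (u n)).
by have := hv n; have := hw n; lra.
Qed.

(* A fixed point [Y] of [Y = (Q + Y^2) / 2] satisfies [(1 - Y)^2 = 1 - Q].
   [majY] is the same iteration with [Q = 1]: it majorizes the norms of the
   iterates of a contraction [Q], and its increments majorize theirs. *)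
Fixpoint majY n : R := if n is m.+1 then (1 + majY m ^+ 2) / 2 else 0.

Lemma majY_bounds n : 0 <= majY n <= 1.
Proof. by elim: n => [|n /andP[h1 h2]] /=; [lra|apply/andP; split; nra]. Qed.

(** The gap [d = 1 - majY n] evolves by [d - d^2 / 2], so it decays like [2 / n]. *)
Lemma majY_rate n : (1 - majY n) * n.+2%:R <= 2.
Proof.
elim: n => [|n IH] /=; first lra.
have /andP[h1 h2] := majY_bounds n.
rewrite -[n.+3]addn1 natrD; set N := n.+2%:R in IH *.
(* In terms of [d] this is [(2 - d N) (2 - d) >= 0], whence [(d - d^2 / 2) (N + 1) <= (4 - d^2) / 2
   <= 2]. *)
have : 0 <= (2 - (1 - majY n) * N) * (1 + majY n) by rewrite mulr_ge0 ?subr_ge0 //; lra.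
by rewrite expr2; nra.
Qed.

Lemma majY_small (d : R) : 0 < d -> exists n, 1 - majY n <= d.
Proof.
move=> d0; have [n hn] := invS_small (divr_gt0 d0 (ltr0Sn R 1)); exists n.
have := majY_rate n; have N0 : 0 < n.+1%:R :> R by rewrite ltr0Sn.
rewrite -(ler_pM2r N0) mulVf ?gt_eqF // in hn.
rewrite -(ler_pM2r N0) -[n.+2]addn1 natrD => h.
by have /andP[h1 h2] := majY_bounds n; nra.
Qed.

Section Contraction.
Variables (Q : H -> H) (sQ : selfadj Q) (nQ : forall x, nrm (Q x) <= nrm x).

Fixpoint iterY n x : H :=
  if n is m.+1 then (1 / 2)%:C *: (Q x + iterY m (iterY m x)) else 0.

Lemma iterY_selfadj n : selfadj (iterY n).
Proof.
elim: n => [|n [bY sY]].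
  split; last by move=> x y; rewrite rdot0l rdot0r.
  apply/bounded_opP; split; first by move=> c x y /=; rewrite scaler0 addr0.
  by exists 0 => // x; rewrite nrm0 mul0r.
split.
  apply: bounded_op_scale; apply: bounded_op_add; first exact: sQ.1.
  exact: bounded_op_comp.
by move=> x y /=; rewrite !rdotE sQ.2 !sY.
Qed.

Lemma iterY_bound n x : nrm (iterY n x) <= majY n * nrm x.
Proof.
elim: n x => [|n IH] x /=; first by rewrite nrm0 mul0r.
have /andP[h1 _] := majY_bounds n.
rewrite nrmZr ger0_norm; last lra.
have := nrmD (Q x) (iterY n (iterY n x)); have := nQ x.
have := IH (iterY n x); have := ler_wpM2l h1 (IH x); lra.
Qed.

Lemma iterY_step n x :
  nrm (iterY n.+1 x - iterY n x) <= (majY n.+1 - majY n) * nrm x.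
Proof.
elim: n x => [|n IH] x.
  have := iterY_bound 1 x; rewrite [iterY 0 x]/= !subr0; done.
have bY k := (iterY_selfadj k).1.
(* The difference of squares is split as [Y' (Y' - Y) + (Y' - Y) Y], with [Y] and [Y'] the iterates
   of index [n] and [n.+1]; this holds without commutation. *)
have -> : iterY n.+2 x - iterY n.+1 x = (1 / 2)%:C *:
   (iterY n.+1 (iterY n.+1 x - iterY n x) +
    (iterY n.+1 (iterY n x) - iterY n (iterY n x))).
  rewrite (opB (bY n.+1)) [in RHS]addrA subrK.
  rewrite {1}[iterY n.+2 x]/= -/(iterY n.+1) [X in _ - X]/= -scalerBr.
  by rewrite opprD addrACA subrr add0r.
rewrite nrmZr ger0_norm; last lra.
apply: (le_trans (ler_wpM2l _ (nrmD _ _))); first lra.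
have /andP[a1 a2] := majY_bounds n; have /andP[b1 b2] := majY_bounds n.+1.
have i0 : 0 <= majY n.+1 - majY n by rewrite /=; nra.
have h1 := iterY_bound n.+1 (iterY n.+1 x - iterY n x).
have h2 := ler_wpM2l b1 (IH x).
have h3 := IH (iterY n x).
have h4 := ler_wpM2l i0 (iterY_bound n x).
have -> : majY n.+2 - majY n.+1 = (majY n.+1 + majY n) * (majY n.+1 - majY n) / 2.
  by rewrite [majY n.+2]/= -/(majY n.+1) {2}[majY n.+1]/=; ring.
by lra.
Qed.

Lemma iterY_cauchy n m x : (n <= m)%N ->
  nrm (iterY m x - iterY n x) <= (majY m - majY n) * nrm x.
Proof.
move=> /subnKC <-; elim: (m - n)%N => [|k IH].
  by rewrite addn0 !subrr nrm0 mul0r.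
rewrite addnS; have := nrmB_trans (iterY (n + k) x) (iterY (n + k).+1 x) (iterY n x).
by have := iterY_step (n + k) x; lra.
Qed.

Lemma contraction_fixpoint : exists Y : H -> H,
  [/\ selfadj Y, forall x, nrm (Y x) <= nrm x &
      forall x, Y x = (1 / 2)%:C *: (Q x + Y (Y x))].
Proof.
have z0 n : 0 <= 1 - majY n by have /andP[] := majY_bounds n; lra.
have bI n := (iterY_selfadj n).1.
have /choice[Y hY] x : exists v, forall n, nrm (v - iterY n x) <= nrm x * (1 - majY n).
  apply: cauchy_rate => [d d0|n m nm].
    have k0 : 0 < nrm x + 1 by rewrite ltr_wpDl ?nrm_ge0.
    have [n hn] := majY_small (divr_gt0 d0 k0); exists n.
    by move: hn; rewrite ler_pdivlMr //; have := z0 n; lra.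
  apply: (le_trans (iterY_cauchy x nm)); rewrite mulrC ler_wpM2l ?nrm_ge0 //.
  by have /andP[] := majY_bounds m; lra.
have nY x : nrm (Y x) <= nrm x.
  (* At [n = 0] both the iterate and [majY] vanish, so the rate is the contraction bound itself. *)
  have := hY x 0%N; rewrite /= !subr0 mulr1; done.
have bY : bounded_op Y.
  apply/bounded_opP; split; last by exists 1 => // x; rewrite mul1r.
  move=> c x y.
  apply: (@lim_unique (fun n => iterY n (c *: x + y)) (fun n => 1 - majY n)
    (nrm (c *: x + y)) (complex.Re `|c| * nrm x + nrm y)).
  - exact: nrm_ge0.
  - by rewrite addr_ge0 ?mulr_ge0 ?nrm_ge0 // normc_def /= sqrtr_ge0.
  - exact: majY_small.
  - by move=> n; exact: hY.
  - move=> n; rewrite (opD (bI n)) (opZ (bI n)) opprD addrACA -scalerBr.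
    apply: (le_trans (nrmD _ _)); rewrite mulrDl lerD // nrmZ -mulrA.
    by rewrite ler_wpM2l // normc_def /= sqrtr_ge0.
exists Y; split=> //.
  split=> // x y; apply/eqP; rewrite -subr_eq0; apply/eqP.
  apply: (@small_eq0 _ _ (fun n => 1 - majY n) (2 * (nrm x * nrm y))).
  - by rewrite !mulr_ge0 ?nrm_ge0.
  - exact: majY_small.
  move=> n.
  have -> : rdot (Y x) y - rdot x (Y y) =
      rdot (Y x - iterY n x) y - rdot x (Y y - iterY n y).
    by rewrite !rdotE (iterY_selfadj n).2; ring.
  apply: (le_trans (ler_normB _ _)).
  have h1 := absCauchySchwarz (Y x - iterY n x) y.
  have h2 := absCauchySchwarz x (Y y - iterY n y).
  have h3 := ler_wpM2r (nrm_ge0 y) (hY x n).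
  have h4 := ler_wpM2l (nrm_ge0 x) (hY y n).
  by lra.
move=> x.
(* Both sides of the fixed point equation are limits of [iterY n.+1 x]. *)
apply: (@lim_unique (fun n => iterY n.+1 x) (fun n => 1 - majY n) (nrm x) (nrm x)).
- exact: nrm_ge0.
- exact: nrm_ge0.
- exact: majY_small.
- move=> n; apply: (le_trans (hY x n.+1)); rewrite ler_wpM2l ?nrm_ge0 //=.
  by have /andP[] := majY_bounds n; nra.
- move=> n; rewrite [iterY n.+1 x]/= -scalerBr opprD addrACA subrr add0r.
  rewrite nrmZr ger0_norm; last lra.
  have h1 := nrmB_trans (iterY n (Y x)) (Y (Y x)) (iterY n (iterY n x)).
  have h2 := hY (Y x) n.
  have h3 := iterY_bound n (Y x - iterY n x); rewrite (opB (bI n)) in h3.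
  have /andP[a1 a2] := majY_bounds n.
  have h4 := hY x n; have h5 := ler_wpM2r (z0 n) (nY x).
  have h6 := ler_wpM2r (nrm_ge0 (Y x - iterY n x)) a2.
  by lra.
Qed.

End Contraction.

(** For a positive bound [M] of [P], [Q = 1 - P / M] is a self-adjoint contraction. Its fixed point
    [Y] gives [(1 - Y)^2 = P / M], so the root is [sqrt M (1 - Y)], positive because [Y] is a
    contraction. *)
Lemma sqrt_exists P : positive_op P -> exists S, is_sqrt_op P S.
Proof.
move=> pP; have [bP sP] := positive_selfadj pP.
have /bounded_opP [_ [M' M'0 hM']] := bP.
pose M := M' + 1; have M0 : 0 < M by rewrite ltr_wpDl.
have hM x : nrm (P x) <= M * nrm x.
  by apply: (le_trans (hM' x)); rewrite ler_wpM2r ?nrm_ge0 // lerDl.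
pose Q x := x + (- M^-1)%:C *: P x.
have bQ : bounded_op Q.
  apply: bounded_op_add; [exact: bounded_op_id|exact: bounded_op_scale].
have sQ : selfadj Q.
  by split=> // x y; rewrite /Q !rdotE sP.
have nQ x : nrm (Q x) <= nrm x.
  rewrite -[leRHS]mul1r; move: x; apply: selfadj_norm => // x.
  rewrite mul1r /Q !rdotE -nrm_sqr.
  have h1 : 0 <= M^-1 * rdot (P x) x.
    by rewrite mulr_ge0 ?invr_ge0 ?(ltW M0) // rdot_positive.
  have h2 : M^-1 * rdot (P x) x <= nrm x ^+ 2.
    rewrite mulrC ler_pdivrMr //; apply: (le_trans (CauchySchwarz _ _)).
    by have := ler_wpM2r (nrm_ge0 x) (hM x); lra.
  by rewrite mulNr ler_norml; lra.
have [Y [sY nY eY]] := contraction_fixpoint sQ nQ.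
have bY := sY.1.
pose S x := (Num.sqrt M)%:C *: (x + (-1)%:C *: Y x).
have bS : bounded_op S.
  do 2![apply: bounded_op_scale || apply: bounded_op_add] => //.
    exact: bounded_op_id.
  exact: bounded_op_scale.
exists S; split.
  apply: selfadj_positive.
    by split=> // x y; rewrite /S !rdotE sY.2.
  move=> x; rewrite /S !rdotE mulr_ge0 ?sqrtr_ge0 // -nrm_sqr.
  have := CauchySchwarz (Y x) x; have := ler_wpM2r (nrm_ge0 x) (nY x).
  by rewrite expr2; lra.
apply/funext => x /=; apply: rdot_ext => z.
rewrite /S (opZ bY) (opD bY) (opZ bY) !rdotE.
have : rdot (Y x) z = rdot ((1 / 2)%:C *: (Q x + Y (Y x))) z by rewrite -eY.
rewrite /Q !rdotE => h.
have hs : Num.sqrt M ^+ 2 = M by rewrite sqr_sqrtr // ltW.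
set s := Num.sqrt M in hs *.
transitivity (M * (rdot x z - 2 * rdot (Y x) z + rdot (Y (Y x)) z)).
  by rewrite -hs; ring.
by rewrite h; field; rewrite gt_eqF.
Qed.

Lemma sqrt_opP P : positive_op P -> is_sqrt_op P (sqrt_op P).
Proof. by move=> /sqrt_exists /getPex. Qed.

End SquareRoot.

(** * The polar decomposition *)

Section Polar.
Context {R : realType} {H : hilbertType R}.
Implicit Types (x y z u v w : H) (a : R) (c : R[i]).
Variables (A : H -> H) (bA : bounded_op A).

Let P := abs_op A.

Lemma abs_op_is_sqrt : is_sqrt_op (adjoint_op A \o A) P.
Proof.
have hB := adjoint_opP bA; set B := adjoint_op A in hB *.
apply: sqrt_opP; apply: selfadj_positive => [|x /=].
  split; first exact: bounded_op_comp hB.1 bA.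
  by move=> x y /=; rewrite rdotC -!(rdot_adjoint _ _ hB) rdotC.
by rewrite rdotC -(rdot_adjoint _ _ hB) -nrm_sqr sqr_ge0.
Qed.

Lemma abs_op_selfadj : selfadj P.
Proof. exact: positive_selfadj abs_op_is_sqrt.1. Qed.

(** This makes [P u |-> A u] a well-defined isometry on the range of [P]; the polar factor extends
    it. *)
Lemma nrm_abs_op x : nrm (P x) = nrm (A x).
Proof.
apply/eqP; rewrite -(@eqrXn2 _ 2) ?nrm_ge0 // !nrm_sqr abs_op_selfadj.2.
have /(congr1 (fun f => f x)) /= -> := abs_op_is_sqrt.2.
by rewrite -(rdot_adjoint _ _ (adjoint_opP bA)).
Qed.

Lemma ker_abs_op x : P x = 0 <-> A x = 0.
Proof.
by split=> h; apply: nrm_eq0; [rewrite -nrm_abs_op|rewrite nrm_abs_op]; rewrite h nrm0.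
Qed.

Let bP : bounded_op P := abs_op_selfadj.1.
Let sP := abs_op_selfadj.2.

(* [v] is the projection of [x] on the closure of the range of [P], and [(v, y)]
   is in the closure of the graph of [P u |-> A u]. *)
Let polar_rel x v y := (forall u, rdot v (P u) = rdot x (P u)) /\
  forall d : R, 0 < d -> exists u, nrm (v - P u) <= d /\ nrm (y - A u) <= d.

Let polar_relD c x v y x' v' y' : polar_rel x v y -> polar_rel x' v' y' ->
  polar_rel (c *: x + x') (c *: v + v') (c *: y + y').
Proof.
move=> [h1 h2] [h1' h2']; split.
  move=> u; rewrite !rdotDl !rdotZ h1'.
  by rewrite -(opZ bP) h1.
move=> d d0.
have c0 : 0 <= complex.Re `|c| by rewrite normc_def /= sqrtr_ge0.
set k := complex.Re `|c| in c0.
have k0 : 0 < k + 1 by rewrite ltr_wpDl.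
have [u [hu1 hu2]] := h2 _ (divr_gt0 d0 k0).
have [u' [hu1' hu2']] := h2' _ (divr_gt0 d0 k0).
have e : k * (d / (k + 1)) + d / (k + 1) = d by field; rewrite gt_eqF.
exists (c *: u + u'); rewrite (opD bP) (opD bA) (opZ bP) (opZ bA).
have dist (p q r s : H) : c *: p + q - (c *: r + s) = c *: (p - r) + (q - s).
  by rewrite opprD addrACA -scalerBr.
rewrite !dist; split; apply: (le_trans (nrmD _ _)); rewrite nrmZ -/k -[leRHS]e lerD //.
  exact: ler_wpM2l.
exact: ler_wpM2l.
Qed.

Let polar_rel_norm x v y : polar_rel x v y -> nrm y = nrm v.
Proof.
move=> [_ h]; apply/eqP; rewrite -subr_eq0; apply/eqP.
apply: (@small_eq0 _ _ (fun n => n.+1%:R^-1) 2) => //.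
  exact: invS_small.
move=> n; have n0 : 0 < n.+1%:R^-1 :> R by rewrite invr_gt0 ltr0Sn.
have [u [h1 h2]] := h _ n0.
have := nrmB_trans (P u) v 0; have := nrmB_trans (A u) y 0.
have := nrmB_trans v (P u) 0; have := nrmB_trans y (A u) 0.
rewrite !subr0 (nrmBC (P u)) (nrmBC (A u)) nrm_abs_op ler_norml.
by set t := n.+1%:R^-1 in n0 h1 h2 *; lra.
Qed.

(** [v - x] is orthogonal to the range of [P], hence to [v], which lies in its closure. *)
Let polar_rel_sqr x v y : polar_rel x v y -> nrm v ^+ 2 = rdot x v.
Proof.
move=> [h1 h2]; rewrite nrm_sqr; apply/eqP; rewrite -subr_eq0 -rdotNl -rdotDl.
apply/eqP; apply: (@small_eq0 _ _ (fun n => n.+1%:R^-1) (nrm (v - x))).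
- exact: nrm_ge0.
- exact: invS_small.
move=> n; have n0 : 0 < n.+1%:R^-1 :> R by rewrite invr_gt0 ltr0Sn.
have [u [hu _]] := h2 _ n0.
have -> : rdot (v - x) v = rdot (v - x) (v - P u).
  by rewrite [RHS](rdotDr v (- P u)) rdotNr [rdot _ (P u)]rdotDl rdotNl h1 subrr oppr0 addr0.
by apply: (le_trans (absCauchySchwarz _ _)); rewrite ler_wpM2l ?nrm_ge0.
Qed.

Let polar_rel_le x v y : polar_rel x v y -> nrm v <= nrm x.
Proof.
move=> /polar_rel_sqr h; apply: sqr_le_mul; rewrite ?nrm_ge0 // h.
exact: CauchySchwarz.
Qed.

(** The difference of the two relations is a relation at [x = 0], where the norm bounds force both
    components to vanish. *)
Let polar_rel_fun x v y v' y' :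
  polar_rel x v y -> polar_rel x v' y' -> v = v' /\ y = y'.
Proof.
move=> h h'; have := polar_relD (-1) h h'; rewrite !scaleN1r addNr => h0.
have v0 : nrm (- v + v') = 0.
  by apply/eqP; rewrite eq_le nrm_ge0 andbT -(nrm0 (H := H)) (polar_rel_le h0).
have y0 : nrm (- y + y') = 0 by rewrite (polar_rel_norm h0).
by split; apply/eqP; rewrite eq_sym -subr_eq0 addrC; apply/eqP/nrm_eq0.
Qed.

Let polar_rel_exists x : exists vy, polar_rel x vy.1 vy.2.
Proof.
have [|||u _|v [h1 h2]] := @variational R H (range P) (rdot x) (nrm x).
- by exists 0 => //; rewrite (op0 bP).
- move=> _ _ a [u _ <-] [u' _ <-]; exists (a%:C *: u + u') => //.
  by rewrite (opD bP) (opZ bP).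
- by move=> u u' a _ _; rewrite !rdotE.
- exact: absCauchySchwarz.
(* [P (u n)] tends to [v], and [A (u n)] is Cauchy because [A] and [P] have equal norms on
   differences. The factor 1/2 lets two errors add up to the rate. *)
have /choice [u hu] n : exists u, nrm (v - P u) <= n.+1%:R^-1 / 2.
  have [|_ [u _ <-] hu] := h2 (n.+1%:R^-1 / 2); last by exists u.
  by rewrite divr_gt0 ?invr_gt0 ?ltr0Sn.
have [y hy] : exists y, forall n, nrm (y - A (u n)) <= n.+1%:R^-1.
  apply: cauchy_rate; first exact: invS_small.
  move=> n m nm; rewrite -(opB bA) -nrm_abs_op (opB bP).
  apply: (le_trans (nrmB_trans v _ _)); rewrite (nrmBC _ v).
  have := hu n; have := hu m; have := @invS_le R n m nm.
  by set s := m.+1%:R^-1; set t := n.+1%:R^-1; lra.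
exists (v, y); split=> /= [w|d d0]; first by apply: h1; exists w.
have [n hn] := invS_small d0; exists (u n); split; last exact: le_trans hn.
apply: (le_trans (hu n)).
have : 0 <= n.+1%:R^-1 :> R by rewrite invr_ge0.
by set t := n.+1%:R^-1 in hn *; lra.
Qed.

Lemma polar_exists : exists U, is_polar_factor A U.
Proof.
have /choice [g hg] := polar_rel_exists.
pose U x := (g x).2; pose p x := (g x).1.
have hU x : polar_rel x (p x) (U x) by exact: hg.
have bU : bounded_op U.
  apply/bounded_opP; split.
    move=> c x y; have := polar_relD c (hU x) (hU y).
    by move=> /(polar_rel_fun (hU _)) [].
  exists 1 => // x; rewrite mul1r (polar_rel_norm (hU x)).
  exact: polar_rel_le (hU x).
have kerU x : U x = 0 <-> A x = 0.
  split=> [U0|/ker_abs_op P0].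
    apply/ker_abs_op; apply: rdot_ext => u; rewrite sP -(hU x).1.
    suff -> : p x = 0 by rewrite !rdot0l.
    by apply: nrm_eq0; rewrite -(polar_rel_norm (hU x)) U0 nrm0.
  have : polar_rel x 0 0.
    split=> [u|d d0]; first by rewrite -[RHS]sP P0 !rdot0l.
    by exists 0; rewrite (op0 bP) (op0 bA) !subrr nrm0 ltW.
  by move=> /(polar_rel_fun (hU x)) [].
exists U; split.
- split=> // x hx; rewrite !normE; congr (_%:C).
  rewrite (polar_rel_norm (hU x)).
  (* [x - p x] is orthogonal to the range of [P], so [P] kills it. Orthogonality of [x] to it then
     gives [|x|^2 = rdot x (p x) = |p x|^2], and [U x] has the norm of [p x]. *)
  have /hx : ker_op U (x - p x).
    apply/kerU/ker_abs_op; apply: rdot_ext => u.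
    by rewrite sP rdotDl rdotNl (hU x).1 subrr rdot0l.
  rewrite dotE => -[+ _]; rewrite rdotDr rdotNr -(polar_rel_sqr (hU x)) -nrm_sqr.
  by move=> h; apply/eqP; rewrite -(@eqrXn2 _ 2) ?nrm_ge0 //; apply/eqP; lra.
- apply/funext => x /=.
  have : polar_rel (P x) (P x) (A x).
    by split=> // d d0; exists x; rewrite !subrr nrm0 ltW.
  by move=> /(polar_rel_fun (hU _)) [].
- by apply/seteqP; split=> x /kerU.
Qed.

Lemma polar_factorP : is_polar_factor A (polar_factor A).
Proof. exact: getPex polar_exists. Qed.

End Polar.

(** * Operator norm and numerical radius *)

Section NumericalRadius.
Context {R : realType} {H : hilbertType R}.
Implicit Types (A B : H -> H) (x y z u v w : H) (c : R[i]).

Lemma Re_normc (z : R[i]) : (complex.Re `|z|)%:C = `|z|.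
Proof. by rewrite RRe_real // normr_real. Qed.

Lemma Re_le_norm (z : R[i]) : complex.Re z <= complex.Re `|z|.
Proof.
have := normc_ge_Re z; rewrite -{2}[`|z|]Re_normc lecR; apply: le_trans.
exact: ler_norm.
Qed.

(** Rotating by [c] turns a modulus into a real part, so that bounds on [rdot] control the numerical
    radius. *)
Lemma phase (z : R[i]) : exists2 c, `|c| = 1 & c * z = `|z|.
Proof.
have [->|z0] := eqVneq z 0.
  by exists 1; rewrite ?normr1 // mulr0 normr0.
exists (`|z| / z); first by rewrite normf_div normr_id divff // normr_eq0.
by rewrite divfK.
Qed.

Lemma norm_dot x y : complex.Re `|dotp x y| <= nrm x * nrm y.
Proof.
have [c c1 <-] := phase (dotp x y).
by rewrite -dotZl (le_trans (CauchySchwarz _ _)) // nrmZ c1 mul1r.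
Qed.

Lemma nrm_normalize x : 0 < nrm x -> nrm ((nrm x)^-1%:C *: x) = 1.
Proof.
by move=> x0; rewrite nrmZr ger0_norm ?invr_ge0 ?nrm_ge0 // mulVf ?gt_eqF.
Qed.

Lemma le_opnorm A x : bounded_op A -> nrm (A x) <= opnorm A * nrm x.
Proof.
move=> bA; have /bounded_opP [_ [M M0 hM]] := bA.
have [/eqP/nrm_eq0 ->|x0] := boolP (nrm x == 0).
  by rewrite (op0 bA) nrm0 mulr0.
have p0 : 0 < nrm x by rewrite lt_neqAle eq_sym x0 nrm_ge0.
have : nrm (A ((nrm x)^-1%:C *: x)) <= opnorm A.
  apply: ub_le_sup; last first.
    by exists ((nrm x)^-1%:C *: x) => //=; rewrite normE nrm_normalize.
  exists M => _ [y /= y1 <-]; apply: (le_trans (hM y)).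
  by rewrite ler_piMr // -lecR -normE.
rewrite (opZ bA) nrmZr ger0_norm ?invr_ge0 ?nrm_ge0 // mulrC.
by rewrite ler_pdivrMr.
Qed.

Lemma le_numrad B c x : bounded_op B -> `|c| = 1 ->
  `|rdot (c *: B x) x| <= numrad B * nrm x ^+ 2.
Proof.
move=> bB c1; have /bounded_opP [_ [M M0 hM]] := bB.
have [/eqP/nrm_eq0 ->|x0] := boolP (nrm x == 0).
  by rewrite rdot0r normr0 nrm0 expr0n mulr0.
have p0 : 0 < nrm x by rewrite lt_neqAle eq_sym x0 nrm_ge0.
set y := (nrm x)^-1%:C *: x.
have y1 : nrm y = 1 by exact: nrm_normalize.
have hy : complex.Re `|dotp (B y) y| <= numrad B.
  apply: ub_le_sup; last by exists y => //=; rewrite normE y1.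
  exists M => _ [z /= z1 <-]; apply: (le_trans (norm_dot _ _)).
  have z1' : nrm z = 1 by rewrite /nrm z1.
  by have := hM z; rewrite z1' !mulr1.
have hc d : `|d| = 1 -> rdot (d *: B x) x <= numrad B * nrm x ^+ 2.
  move=> d1; rewrite -ler_pdivrMr ?exprn_gt0 //.
  have -> : rdot (d *: B x) x / nrm x ^+ 2 = rdot (d *: B y) y.
    have -> : d *: B y = (nrm x)^-1%:C *: (d *: B x).
      by rewrite (opZ bB) !scalerA mulrC.
    rewrite /y !rdotE.
    by field; rewrite gt_eqF.
  apply: le_trans hy; rewrite /rdot dotZl; apply: (le_trans (Re_le_norm _)).
  by rewrite normrM d1 mul1r.
(* The lower bound is the upper bound for the phase [- c]. *)
rewrite ler_norml hc // andbT lerNl -rdotNl -scaleNr hc //.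
by rewrite normrN.
Qed.

Lemma numrad_le B (N : R) : 0 <= N ->
  (forall c x, `|c| = 1 -> nrm x = 1 -> rdot (c *: B x) x <= N) -> numrad B <= N.
Proof.
move=> N0 h; rewrite /numrad; set E := [set _ | _ in _].
(* If [H] has no unit vector the supremum is that of the empty set, 0, and [0 <= N] settles the
   case. *)
have [->|/set0P E0] := eqVneq E set0; first by rewrite sup0.
apply: ge_sup => // _ [x /= x1 <-].
have [c c1 e] := phase (dotp (B x) x).
have := h c x c1; rewrite /rdot dotZl e /nrm x1; exact.
Qed.

End NumericalRadius.

(** * The bound through the Aluthge transform *)

Section Aluthge.
Context {R : realType} {H : hilbertType R}.
Implicit Types (x y : H) (c : R[i]).
Variables (A : H -> H) (bA : bounded_op A).

Let P := abs_op A.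
Let S := sqrt_op P.
Let U := polar_factor A.
Let Us := adjoint_op U.
Let At := aluthge A.

Let bP : bounded_op P := (abs_op_selfadj bA).1.
Let sP : forall x y, rdot (P x) y = rdot x (P y) := (abs_op_selfadj bA).2.
Let isS : is_sqrt_op P S.
Proof. exact: sqrt_opP (abs_op_is_sqrt bA).1. Qed.
Let sS := (positive_selfadj isS.1).2.
Let bS : bounded_op S := isS.1.1.
Let SS x : S (S x) = P x.
Proof. by have /(congr1 (fun f => f x)) := isS.2. Qed.

Let bU : bounded_op U.
Proof. by have [[]] := polar_factorP bA. Qed.
Let UsP : is_adjoint U Us.
Proof. exact: adjoint_opP. Qed.
Let bUs : bounded_op Us := UsP.1.
Let AE x : A x = U (P x).
Proof. by have [_ /(congr1 (fun f => f x))] := polar_factorP bA. Qed.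
Let AtE x : At x = S (U (S x)).
Proof. by []. Qed.
Let bAt : bounded_op At.
Proof. by apply: bounded_op_comp => //; apply: bounded_op_comp. Qed.

(** [S y] is orthogonal to [ker U]: this kernel is that of [A], hence of [P], and [P w = 0] gives
    [|S w|^2 = rdot (P w) w = 0]. *)
Let nrmUS y : nrm (U (S y)) = nrm (S y).
Proof.
have [[_ iU] _ kU] := polar_factorP bA.
rewrite /nrm iU // => w; rewrite kU => /(ker_abs_op bA); rewrite -/P => Pw.
have Sw : S w = 0.
  by apply: nrm_eq0; apply/eqP; rewrite -sqrf_eq0 nrm_sqr -sS SS Pw rdot0l.
by rewrite dotE !sS (opZ bS) Sw scaler0 rdot0r.
Qed.

Let K := opnorm A ^+ 2 + numrad At ^+ 2 + numrad ((P \o At) \+ (At \o P)).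

Section Phase.
Variables (c : R[i]) (c1 : `|c| = 1).

Let D y := (1 / 2)%:C *: (c *: At y + conjc c *: S (Us (S y))).

(** [S \o Us \o S] is the adjoint of [At], so [D] is indeed the real part of [c At]. *)
Let AtC x y : rdot (c *: At x) y = rdot x (conjc c *: S (Us (S y))).
Proof.
by rewrite rdotZ AtE sS (rdot_adjoint _ _ UsP) sS (opZ bS) (opZ bUs) (opZ bS).
Qed.

Let sD : selfadj D.
Proof.
split.
  apply: bounded_op_scale; apply: bounded_op_add; apply: bounded_op_scale => //.
  by apply: bounded_op_comp => //; apply: bounded_op_comp.
move=> x y; rewrite /D !rdotE AtC.
by rewrite [rdot (conjc c *: _) y]rdotC -[rdot y _]AtC [rdot (c *: _) x]rdotC addrC.
Qed.

Let rdotD y : rdot (D y) y = rdot (c *: At y) y.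
Proof.
rewrite /D !rdotE.
have -> : rdot (conjc c *: S (Us (S y))) y = rdot (c *: At y) y.
  by rewrite rdotC -AtC.
by lra.
Qed.

Let nrmD y : nrm (D y) <= numrad At * nrm y.
Proof. by apply: selfadj_norm => // x; rewrite rdotD; exact: le_numrad. Qed.

Let nrmB_sqr y : nrm (P y + D y) ^+ 2 <= K * nrm y ^+ 2.
Proof.
have cross : 2 * rdot (P y) (D y) <=
    numrad ((P \o At) \+ (At \o P)) * nrm y ^+ 2.
  (* The two halves of [D] give [rdot (c *: P (At y)) y] and, moving the adjoint across,
     [rdot (c *: At (P y)) y]. *)
  have -> : 2 * rdot (P y) (D y) = rdot (c *: ((P \o At) \+ (At \o P)) y) y.
    rewrite /D !rdotE /= scalerDr rdotDl -AtC.
    by rewrite sP (opZ bP) (rdotC y); lra.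
  apply: (le_trans (ler_norm _)); apply: le_numrad => //.
  by apply: bounded_op_add; apply: bounded_op_comp.
have hP : nrm (P y) ^+ 2 <= opnorm A ^+ 2 * nrm y ^+ 2.
  by rewrite -exprMn ler_pXn2r ?nnegrE ?nrm_ge0 ?(nrm_abs_op bA) ?(le_trans _ (le_opnorm _ bA)) ?le_opnorm ?nrm_ge0.
have hD : nrm (D y) ^+ 2 <= numrad At ^+ 2 * nrm y ^+ 2.
  by rewrite -exprMn ler_pXn2r ?nnegrE ?nrm_ge0 ?(le_trans _ (nrmD _)) ?nrm_ge0.
rewrite nrm_sqr !rdotDl !rdotDr -!nrm_sqr (rdotC (D y)) /K; lra.
Qed.

Let N := Num.sqrt K.

Let nrmB y : nrm (P y + D y) <= N * nrm y.
Proof.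
have [/eqP/nrm_eq0 ->|x0] := boolP (nrm y == 0).
  by rewrite (op0 bP) (op0 sD.1) addr0 nrm0 mulr0.
have p0 : 0 < nrm y by rewrite lt_neqAle eq_sym x0 nrm_ge0.
(* The sign of [K] is read off from [nrmB_sqr] at a nonzero vector. *)
have K0 : 0 <= K.
  rewrite -(pmulr_lge0 _ (exprn_gt0 2 p0)); apply: le_trans (nrmB_sqr y).
  exact: sqr_ge0.
rewrite -(@ler_pXn2r _ 2) ?nnegrE ?mulr_ge0 ?sqrtr_ge0 ?nrm_ge0 //.
by rewrite exprMn sqr_sqrtr.
Qed.

(* [T] and [Ts] are adjoint to each other, and [T Ts = 2 (P + D)]. *)
Let T x := S (c *: x + Us x).
Let Ts y := conjc c *: S y + U (S y).

Let cc : c * conjc c = 1.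
Proof. by rewrite -sqr_normc c1 expr1n. Qed.

Let nrmTs y : nrm (Ts y) ^+ 2 <= 2 * N * nrm y ^+ 2.
Proof.
(* The squares [|S y|^2] and [|U (S y)|^2] both equal [rdot (P y) y], and the cross terms add up to
   [2 rdot (D y) y]. *)
have -> : nrm (Ts y) ^+ 2 = 2 * rdot (P y + D y) y.
  rewrite nrm_sqr /Ts !rdotDl !rdotDr rdotD.
  rewrite [X in X + _ + _]rdotZ conjcK scalerA cc scale1r -!nrm_sqr nrmUS.
  rewrite nrm_sqr -sS SS (rdotC (U _)) rdotZ conjcK.
  by rewrite -(opZ bU) -(opZ bS) sS -AtE (opZ bAt) [rdot y _]rdotC; ring.
have := CauchySchwarz (P y + D y) y.
have := ler_wpM2r (nrm_ge0 y) (nrmB y); lra.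
Qed.

Let T_Ts x y : rdot (T x) y = rdot x (Ts y).
Proof.
rewrite /T /Ts sS rdotDl rdotDr rdotZ [rdot (Us x) _]rdotC.
by rewrite -(rdot_adjoint _ _ UsP) (rdotC (U _)).
Qed.

(** An operator inherits the norm bound of its adjoint: [|T x|^2 <= |x| |Ts (T x)|], which is
    squared and divided by [|T x|^2]. *)
Let nrmT x : nrm (T x) ^+ 2 <= 2 * N * nrm x ^+ 2.
Proof.
have N0 : 0 <= N by exact: sqrtr_ge0.
set y := T x; have h1 : nrm y ^+ 2 <= nrm x * nrm (Ts y).
  by rewrite nrm_sqr {1}/y T_Ts CauchySchwarz.
have [->|y0] := eqVneq (nrm y) 0.
  by rewrite expr0n /= mulr_ge0 ?sqr_ge0 // mulr_ge0.
have p0 : 0 < nrm y ^+ 2 by rewrite exprn_even_gt0.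
rewrite -(ler_pM2r p0).
have h2 := ler_wpM2l (sqr_ge0 (nrm x)) (nrmTs y).
have : (nrm y ^+ 2) ^+ 2 <= (nrm x * nrm (Ts y)) ^+ 2.
  by rewrite ler_pXn2r ?nnegrE ?mulr_ge0 ?nrm_ge0 ?sqr_ge0.
rewrite exprMn => h3; lra.
Qed.

Lemma rdot_aluthge x : rdot (c *: A x) x <= 1 / 2 * Num.sqrt K * nrm x ^+ 2.
Proof.
(* Polarization of [rdot (S (c *: x)) (S (Us x))]. The subtracted square is dropped, and [2 * N / 4]
   gives the factor 1/2. *)
have -> : rdot (c *: A x) x =
   (nrm (T x) ^+ 2 - nrm (S (c *: x - Us x)) ^+ 2) / 4.
  have -> : rdot (c *: A x) x = rdot (S (c *: x)) (S (Us x)).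
    by rewrite AE -(opZ bU) (rdot_adjoint _ _ UsP) -(opZ bP) -SS sS.
  by rewrite /T (opD bS) (opB bS) !nrm_sqr !rdotE (rdotC (S (Us x))); lra.
have := sqr_ge0 (nrm (S (c *: x - Us x))).
have := nrmT x; rewrite /N; lra.
Qed.

End Phase.

Lemma numrad_aluthge : numrad A <= 1 / 2 * Num.sqrt K.
Proof.
apply: numrad_le => [|c x c1 x1]; first by rewrite mulr_ge0 ?sqrtr_ge0.
by have := rdot_aluthge c1 x; rewrite x1 expr1n mulr1.
Qed.

End Aluthge.

Theorem theorem2p6 (R : realType) (H : hilbertType R) (A : H -> H)
    (hA : bounded_op A) :
  numrad A <= 1 / 2 * Num.sqrt
    (opnorm A ^+ 2 + numrad (aluthge A) ^+ 2
     + numrad ((abs_op A \o aluthge A) \+ (aluthge A \o abs_op A))).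
Proof. exact: numrad_aluthge. Qed.
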